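(* Let $m\ge 1$ and let $x\in\mathbb{Q}_{\ge 1}$ be a rational number with finite continued fraction $x=[a_1,a_2,\ldots,a_n]$, where all $a_i$ are positive integers. Then \[ r_{m,m}(x)=\frac{\#\Omega_m(\mathcal{G}[a_1,\ldots,a_n])}{\#\Omega_m(\mathcal{G}[a_2,\ldots,a_n])}. \]
   Context: Snake graphs. A tile is a planar graph with four vertices and four edges having the shape of a (unit, axis-parallel) square. A snake graph is a connected planar graph consisting of a finite sequence of tiles $G_1,\ldots,G_d$ such that for each $i=1,\ldots,d-1$ the tiles $G_i$ and $G_{i+1}$ share exactly one edge $e_i$, and $e_i$ is either the north edge of $G_i$ and the south edge of $G_{i+1}$, or the east edge of $G_i$ and the west edge of $G_{i+1}$. A sign function on a snake graph is a map $f$ from its edges to $\{+,-\}$ such that on every tile the north and west edges have the same sign, the south and east edges have the same sign, and the north edge has sign opposite to the south edge. For positive integers $a_1,\ldots,a_n$ let $d=a_1+\cdots+a_n-1$ and let $(s_0,s_1,\ldots,s_d)$ be the sign sequence consisting of $a_1$ signs $-$, followed by $a_2$ signs $+$, followed by $a_3$ signs $-$, and so on alternately. Then $\mathcal{G}[a_1,\ldots,a_n]$ is the unique snake graph with $d$ tiles admitting a sign function $f$ with $f(e_0)=s_0$, where $e_0$ is the south edge of $G_1$, and $f(e_i)=s_i$ for $1\le i\le d-1$. If $d=0$ the graph is a single edge with its two endpoints. An $m$-dimer cover of a graph is a multiset of edges such that every vertex is incident to exactly $m$ edges of the multiset (counted with multiplicity). $\Omega_m(\mathcal{G})$ is the set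 of $m$-dimer covers of $\mathcal{G}$. When $n=1$, the denominator $\#\Omega_m(\mathcal{G}[a_2,\ldots,a_n])$ (empty sequence) is read as $1$. Continued fractions. $[a_1,\ldots,a_n]=a_1+\cfrac{1}{a_2+\cfrac{1}{\ddots+\cfrac{1}{a_n}}}$. The numbers $r_{i,m}$. For a positive integer $a$ set $[\![a]\!]_k=\binom{a+k-1}{k}$ for $k\ge 0$ and $[\![a]\!]_k=0$ for $k<0$. $\Lambda^{(m)}(a)$ is the $(m+1)\times(m+1)$ matrix with $(i,j)$-entry $[\![a]\!]_{m+2-i-j}$. With $X=\Lambda^{(m)}(a_1)\cdots\Lambda^{(m)}(a_n)$, set $r_{i,m}(a_1,\ldots,a_n)=X_{m+1-i,1}/X_{m+1,1}$ for $0\le i\le m$. For $x=[a_1,\ldots,a_n]$ set $r_{m,m}(x)=r_{m,m}(a_1,\ldots,a_n)$ (this does not depend on which of the two finite continued fraction expansions of $x$ is used). *)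

(* Defs.v *)
From mathcomp Require Import all_boot all_order all_algebra.
From mathcomp Require Import zify.

Set Implicit Arguments.
Unset Strict Implicit.
Unset Printing Implicit Defensive.

Import Order.TTheory GRing.Theory Num.Theory.

(* Loopless graphs given by their incidence relation. *)
Record graph := Graph {
  vertex : finType;
  gedge : finType;
  incident : vertex -> gedge -> bool }.

(* A multiset of edges is its multiplicity function. *)
Definition dimer_cover (G : graph) (m : nat) (g : gedge G -> nat) : bool :=
  [forall v : vertex G, \sum_(e : gedge G | incident v e) g e == m].

(* In a graph whose edges all have an endpoint, every multiplicity in an
   m-dimer cover is at most m; this is why [Omega] loses nothing by taking
   multiplicities in 'I_m.+1. *)
Lemma dimer_cover_le (G : graph) (m : nat) (g : gedge G -> nat) v e :
  dimer_cover m g -> incident v e -> g e <= m.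
Proof. by move=> /forallP/(_ v)/eqP <- ve; rewrite (bigD1 e) //= leq_addr. Qed.

Definition Omega (m : nat) (G : graph) : {set {ffun gedge G -> 'I_m.+1}} :=
  [set g : {ffun gedge G -> 'I_m.+1} |
    dimer_cover m (fun e => nat_of_ord (g e))].

(* An edge of the lattice is the pair of its endpoints, the lower (for vertical
   edges) or left (for horizontal edges) one first, so that the common edge of
   two tiles is literally the same object. A tile is given by its lower left
   corner. *)
Definition point : Type := (nat * nat)%type.
Definition edge : Type := (point * point)%type.

Definition south (t : point) : edge := (t, (t.1.+1, t.2)).
Definition north (t : point) : edge := ((t.1, t.2.+1), (t.1.+1, t.2.+1)).
Definition west (t : point) : edge := (t, (t.1, t.2.+1)).
Definition east (t : point) : edge := ((t.1.+1, t.2), (t.1.+1, t.2.+1)).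

Definition tile_edges (t : point) : seq edge :=
  [:: south t; north t; west t; east t].

Notation tile ts i := (nth (0, 0) ts i).

(* Tiles are numbered from 0, so [tile ts i] is G_{i+1}. Snake graphs are
   normalized up to translation by putting the first tile at the origin. *)
Definition is_snake (ts : seq point) : Prop :=
  tile ts 0 = (0, 0) /\
  forall i, i.+1 < size ts ->
    north (tile ts i) = south (tile ts i.+1) \/
    east (tile ts i) = west (tile ts i.+1).

(* The graph without tiles is a single edge. *)
Definition snake_edges (ts : seq point) : seq edge :=
  if ts is [::] then [:: south (0, 0)] else flatten (map tile_edges ts).

Definition snake_vertices (ts : seq point) : seq point :=
  flatten [seq [:: e.1; e.2] | e <- snake_edges ts].

Definition snake_graph (ts : seq point) : graph :=
  @Graph (seq_sub (snake_vertices ts)) (seq_sub (snake_edges ts))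
    (fun v e => (val v == (val e).1) || (val v == (val e).2)).

(* Signs are booleans: + is true and - is false. A sign function is given on
   all lattice edges, but constrained only on those of the snake graph. *)
Definition sign_function (ts : seq point) (f : edge -> bool) : Prop :=
  forall t, t \in ts ->
    [/\ f (north t) = f (west t), f (south t) = f (east t)
      & f (north t) = ~~ f (south t)].

Fixpoint signs_from (s : bool) (a : seq nat) : seq bool :=
  if a is x :: a' then nseq x s ++ signs_from (~~ s) a' else [::].

Definition sign_seq (a : seq nat) : seq bool := signs_from false a.

Definition is_cf_snake (a : seq nat) (ts : seq point) : Prop :=
  [/\ size ts = (sumn a).-1, is_snake ts
    & exists f : edge -> bool,
      [/\ sign_function ts f,
          0 < size ts -> f (south (tile ts 0)) = nth false (sign_seq a) 0
        & forall (i : nat) (e : edge), i.+1 < size ts ->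
            e \in tile_edges (tile ts i) -> e \in tile_edges (tile ts i.+1) ->
            f e = nth false (sign_seq a) i.+1]].

(* The tiles of the snake graph in closed form: up to a global sign, the only
   sign function is the checkerboard one, under which the east edge of G_{j+1}
   has sign s_0 exactly when j is even. *)
Fixpoint cf_tile (a : seq nat) (i : nat) : point :=
  if i is j.+1 then
    let t := cf_tile a j in
    if nth false (sign_seq a) i == nth false (sign_seq a) 0 (+) odd j
    then (t.1.+1, t.2) else (t.1, t.2.+1)
  else (0, 0).

Definition cf_tiles (a : seq nat) : seq point :=
  mkseq (cf_tile a) (sumn a).-1.

Lemma cf_tile_diag a i : (cf_tile a i).1 + (cf_tile a i).2 = i.
Proof. by elim: i => //= i IH; case: ifP => _ /=; lia. Qed.

Lemma shared_east x y e : e \in tile_edges (x, y) ->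
  e \in tile_edges (x.+1, y) -> e = east (x, y).
Proof.
rewrite !inE /south /north /west /east /=.
case: e => [[e1 e2] [e3 e4]]; rewrite !xpair_eqE => H1 H2.
by apply/eqP; rewrite !xpair_eqE; lia.
Qed.

Lemma shared_north x y e : e \in tile_edges (x, y) ->
  e \in tile_edges (x, y.+1) -> e = north (x, y).
Proof.
rewrite !inE /south /north /west /east /=.
case: e => [[e1 e2] [e3 e4]]; rewrite !xpair_eqE => H1 H2.
by apply/eqP; rewrite !xpair_eqE; lia.
Qed.

Definition checker (s : bool) (e : edge) : bool :=
  s (+) (e.1.1 == e.2.1) (+) odd (e.1.1 + e.1.2).

Lemma is_cf_snake_cf_tiles a : is_cf_snake a (cf_tiles a).
Proof.
have szE : size (cf_tiles a) = (sumn a).-1 by rewrite size_mkseq.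
have tE i : i < (sumn a).-1 -> tile (cf_tiles a) i = cf_tile a i.
  by move=> lti; rewrite nth_mkseq.
split=> //.
  split=> [|i]; first by case: (posnP (sumn a).-1) => [E|/tE //]; rewrite nth_default ?szE ?E.
  rewrite szE => lti; rewrite !tE ?(ltnW lti) //=.
  by case: ifP => _; [right | left].
exists (checker (nth false (sign_seq a) 0)); split.
- move=> [x y] _; rewrite /checker /= ?addnS ?addSn /= !eqxx !(ltn_eqF (ltnSn _)) /=.
  by case: (nth _ _ 0); case: (odd _).
- rewrite szE => /tE-> /=.
  by rewrite /checker /= addbF addbF.
move=> i e; rewrite szE => lti; rewrite !tE ?(ltnW lti) //=.
have diag := cf_tile_diag a i; case: (cf_tile a i) diag => x y /= diag.
case: eqP => [->|/eqP/negPf neq] e1 e2.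
  rewrite (shared_east e1 e2) /checker /= eqxx diag /=.
  by case: (nth _ _ 0); case: (odd _).
rewrite (shared_north e1 e2) /checker /= addnS diag /= (ltn_eqF (ltnSn _)).
by move: neq; case: (nth _ _ 0); case: (odd _); case: (nth _ _ i.+1).
Qed.

Lemma is_cf_snake_unique a ts : is_cf_snake a ts -> cf_tiles a = ts.
Proof.
move=> [szE [ts0 snk] [f [sgn f0 fi]]].
suff H i : i < size ts ->
    tile ts i = cf_tile a i /\
    f (south (tile ts i)) = nth false (sign_seq a) 0 (+) odd i.
  apply: (@eq_from_nth _ (0, 0)); rewrite size_mkseq // => i.
  by rewrite -szE => lti; rewrite nth_mkseq -?szE //; case: (H i lti).
elim: i => [lt0|i IH lti].
  by split; [exact: ts0 | rewrite f0 // addbF].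
have [tE fE] := IH (ltnW lti).
have [n1 s1 ns1] := sgn _ (mem_nth (0, 0) (ltnW lti)).
have [n2 s2 ns2] := sgn _ (mem_nth (0, 0) lti).
have fs e := fi i e lti.
case: (snk i lti) => adj.
  have fS : f (north (tile ts i)) = nth false (sign_seq a) i.+1.
    by apply: fs; [|rewrite adj]; rewrite !inE eqxx ?orbT.
  have fS' : f (south (tile ts i.+1)) = nth false (sign_seq a) 0 (+) odd i.+1.
    by rewrite -adj ns1 fE /= addbN.
  split=> //=; rewrite -tE -fS adj fS' /= addbN.
  move: adj; case: (tile ts i) => x y; case: (tile ts i.+1) => x' y'.
  by case=> <- <- _ _ /=; case: (_ (+) _).
have fS : f (east (tile ts i)) = nth false (sign_seq a) i.+1.
  by apply: fs; [|rewrite adj]; rewrite !inE eqxx ?orbT.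
have fS' : f (west (tile ts i.+1)) = nth false (sign_seq a) 0 (+) odd i.
  by rewrite -adj -s1 fE.
split=> /=; last by rewrite -[LHS]negbK -ns2 n2 fS' addbN.
rewrite -tE -fS adj fS' eqxx.
by move: adj; case: (tile ts i) => x y; case: (tile ts i.+1) => x' y' [-> ->].
Qed.

Lemma cf_snake_sig a : {ts | unique (is_cf_snake a) ts}.
Proof.
exists (cf_tiles a).
by split; [exact: is_cf_snake_cf_tiles | exact: is_cf_snake_unique].
Qed.

Definition cf_snake (a : seq nat) : seq point := sval (cf_snake_sig a).

Lemma cf_snakeE a : cf_snake a = cf_tiles a.
Proof.
by case: (svalP (cf_snake_sig a)) => /is_cf_snake_unique ->.
Qed.

(* The empty sequence gets 1 by convention; it is only met as the denominator
   for a sequence of length 1. *)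
Definition numOmega (m : nat) (a : seq nat) : nat :=
  if a is [::] then 1 else #|Omega m (snake_graph (cf_snake a))|.

Local Open Scope ring_scope.

(* [:: a_n] is sent to a_n since 0^-1 = 0. *)
Fixpoint cfrac (a : seq nat) : rat :=
  if a is x :: a' then x%:R + (cfrac a')^-1 else 0.

Definition bracket (a : nat) (k : int) : rat :=
  if k is Posz k' then 'C((a + k').-1, k')%:R else 0.

(* Indices start at 0 here, so the 1-based m + 2 - i - j becomes m - i - j,
   and the 1-based X_{m+1-i,1} is row m - i, column 0. *)
Definition Lambda (m a : nat) : 'M[rat]_m.+1 :=
  \matrix_(i < m.+1, j < m.+1) bracket a (m%:Z - i%:Z - j%:Z).

Definition r_seq (i m : nat) (a : seq nat) : rat :=
  let X := \prod_(x <- a) Lambda m x in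
  X (inord (m - i)) ord0 / X ord_max ord0.

(* The expansion of p / q by the Euclidean algorithm. *)
Fixpoint euclid (fuel p q : nat) : seq nat :=
  if fuel is k.+1 then
    if q == 0%N then [::] else (p %/ q)%N :: euclid k q (p %% q)%N
  else [::].

Definition cf_expansion (x : rat) : seq nat :=
  euclid `|denq x|.+1 `|numq x| `|denq x|.

(* By [r_ratE] below, any other continued fraction expansion of x would do. *)
Definition r_rat (i m : nat) (x : rat) : rat := r_seq i m (cf_expansion x).

Fixpoint continuant (a : seq nat) : nat * nat :=
  if a is x :: a' then
    let pq := continuant a' in ((x * pq.1 + pq.2)%N, pq.1)
  else (1%N, 0%N).

(* Merges a final 1 into its predecessor. *)
Fixpoint cf_normal (a : seq nat) : seq nat :=
  if a is x :: a' then
    if a' is [:: 1%N] then [:: x.+1] else x :: cf_normal a'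
  else [::].

Lemma continuant_spec a : all (leq 1) a ->
  [/\ coprime (continuant a).1 (continuant a).2, (0 < (continuant a).1)%N,
      a != [::] -> (0 < (continuant a).2 <= (continuant a).1)%N
      & (continuant a).2 = (continuant a).1 -> a = [:: 1%N]].
Proof.
elim: a => // x a IH /= /andP[x0 /IH[cop p0 le eq]].
split.
- by rewrite coprime_sym /coprime gcdnMDl.
- by nia.
- by nia.
case: a {IH} le eq cop p0 => [|y a] le eq cop p0 E.
  by congr [:: _]; move: E => /=; nia.
by have := le isT; nia.
Qed.

Lemma euclid_continuant a k : all (leq 1) a -> a != [::] ->
  ((continuant a).2 < k)%N ->
  euclid k (continuant a).1 (continuant a).2 = cf_normal a.
Proof.
elim: a k => // x a IH [//|k] /= /andP[x0 pos] _.
have [cop p0 le eq] := continuant_spec pos.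
rewrite ltnS => ltk; rewrite gtn_eqF //.
have [a1|na1] := eqVneq a [:: 1%N].
  rewrite a1 /= !muln1 addn1 divn1 modn1.
  by case: (k).
have ltqp : ((continuant a).2 < (continuant a).1)%N.
  rewrite ltn_neqAle; apply/andP; split; first by apply: contraNneq na1 => /eq ->.
  by case: (a) le => // y b /(_ isT)/andP[].
rewrite divnMDl // divn_small // addn0 modnMDl modn_small //.
case: a IH na1 {eq} pos cop le ltk p0 ltqp => [|y a] IH na1 pos cop le ltk p0 ltqp.
  by case: k {ltk IH}.
rewrite IH //; last exact: leq_trans ltqp ltk.
by case: y na1 {le cop ltqp ltk p0 pos IH} => [|[|y]] //; case: a.
Qed.

Lemma cfracE a : all (leq 1) a -> a != [::] ->
  cfrac a = (continuant a).1%:R / (continuant a).2%:R.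
Proof.
elim: a => // x a IH /andP[x0 pos] _.
have [->|na] := eqVneq a [::].
  by rewrite /= invr0 addr0 muln1 addn0 divr1.
have [_ p0 le _] := continuant_spec pos.
rewrite /= (IH pos na) invf_div natrD natrM mulrDl mulfK //.
by rewrite pnatr_eq0 -lt0n.
Qed.

Lemma cf_expansion_cfrac a : all (leq 1) a -> a != [::] ->
  cf_expansion (cfrac a) = cf_normal a.
Proof.
move=> pos na; have [cop p0 le _] := continuant_spec pos.
have /andP[q0 _] := le na.
rewrite /cf_expansion cfracE // !pmulrn coprimeq_num ?coprimeq_den //.
rewrite gt_eqF // gtr0_sg // mul1r.
exact: euclid_continuant.
Qed.

Lemma hockey_stick x k :
  (\sum_(j < k.+1) 'C((x + j).-1, j) = 'C((x.+1 + k).-1, k))%N.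
Proof.
elim: k => [|k IH]; first by rewrite big_ord1 !bin0.
by rewrite big_ord_recr /= IH !addSn !addnS /= binS addnC.
Qed.

Lemma Lambda1_col m j : Lambda m 1 j ord0 = 1.
Proof. by rewrite mxE subr0 subzn -1?ltnS //= binn. Qed.

Lemma Lambda_merge m x i :
  \sum_j Lambda m x i j * Lambda m 1 j ord0 = Lambda m x.+1 i ord0.
Proof.
have lei : (i <= m)%N by rewrite -ltnS.
under eq_bigr => j _ do rewrite Lambda1_col mulr1 mxE.
rewrite mxE subr0 subzn //= -hockey_stick natr_sum.
rewrite -(big_mkord xpredT (fun j : nat => bracket x (Posz (m - i) - Posz j))).
rewrite (@big_cat_nat _ _ _ (m - i).+1) ?ltnS ?leq_subr //=.
rewrite [X in _ + X]big_nat_cond [X in _ + X]big1 ?addr0; last first.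
  move=> j /andP[/andP[lej _] _].
  by case E: (_ - _) => [k|//]; exfalso; lia.
rewrite big_mkord (reindex_inj rev_ord_inj) /=.
by apply: eq_bigr => j _; rewrite subSS subzn ?leq_subr // subKn // -ltnS.
Qed.

Lemma prod_Lambda_normal m a i :
  (\prod_(x <- cf_normal a) Lambda m x) i ord0 =
  (\prod_(x <- a) Lambda m x) i ord0.
Proof.
elim: a i => // x a IH i /=.
have [->|na] := eqVneq a [:: 1%N].
  by rewrite !big_cons big_nil !mulr1 [RHS]mxE Lambda_merge.
have -> : (if a is [:: 1%N] then [:: x.+1] else x :: cf_normal a) =
          x :: cf_normal a by case: a na {IH} => [|[|[|y]] [|z a]].
by rewrite !big_cons !mxE; apply: eq_bigr => j _; rewrite IH.
Qed.

Lemma r_ratE i m a : all (leq 1) a -> a != [::] ->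
  r_rat i m (cfrac a) = r_seq i m a.
Proof.
move=> pos na.
by rewrite /r_rat cf_expansion_cfrac // /r_seq !prod_Lambda_normal.
Qed.

(* Main.v *)
Require Import Defs.
From mathcomp Require Import all_boot all_order all_algebra.
From mathcomp Require Import zify.

Set Implicit Arguments.
Unset Strict Implicit.
Unset Printing Implicit Defensive.

Import Order.TTheory GRing.Theory Num.Theory.

(** Both sides of the identity count the same walks on {0, ..., m}.

    Dimer side. Sort the vertices of a snake graph with d > 0 tiles by
    antidiagonal: the first and the last antidiagonal have one vertex, the d
    others have two, the north-west and south-east corners of one tile, and
    every edge joins consecutive antidiagonals. In an m-dimer cover the total
    multiplicity of the edges between two consecutive antidiagonals is
    therefore m, so at each tile k one number h_k in {0, ..., m} tells how the
    m units arriving from below are shared by its two corners. Between two such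
    antidiagonals the edges form a path, so consecutive h determine all their
    multiplicities ([lo_inflow], [hi_inflow]), and these are nonnegative exactly
    when h_k - h_(k-1) has the sign prescribed by s_k. The parity of k enters
    the choice of the corner measured by h_k ([corner]); this is what makes the
    condition depend on s_k alone and not on the direction of the step of the
    snake. Hence covers are walks that start at 0, go weakly up at each sign -
    and weakly down at each sign + ([card_Omega_walks]).

    Matrix side. Lambda(0) is the permutation matrix of i |-> m - i, and
    Lambda(x+1) is obtained from Lambda(x) by multiplying by the matrix of weak
    up-steps ([Lambda0], [LambdaS]). So Lambda(a) performs a weak up-steps and
    then a reflection, which turns the down-steps of the next block into
    up-steps, and the (0, 0) entry of Lambda(a_1) ... Lambda(a_n) counts the
    walks that take one step for each of the a_1 + ... + a_n signs and end at
    m or at 0, according to the last sign. The last step is then forced, which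
    leaves one free step per tile ([size_walks_Lambda], [numOmega_Lambda]).

    Finally the last row of Lambda(a_1) is (1, 0, ..., 0), so the denominator
    of r_{m,m} is the (0, 0) entry of Lambda(a_2) ... Lambda(a_n). *)

(** * Edges and corners of a snake, by antidiagonal *)

Definition incid (v : point) (e : edge) : bool := (v == e.1) || (v == e.2).

(** For signs with s_0 = -, these are the tiles of the snake graph with sign
    sequence s ([cf_tile_at]). *)
Fixpoint tile_at (s : nat -> bool) (k : nat) : point :=
  if k is j.+1 then
    let t := tile_at s j in
    if s k == odd j then (t.1.+1, t.2) else (t.1, t.2.+1)
  else (0, 0).

Lemma tile_at_level s k : (tile_at s k).1 + (tile_at s k).2 = k.
Proof. by elim: k => //= k IH; case: ifP => _ /=; lia. Qed.

(** Together with the direction of an edge, its lower antidiagonal is a cheap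
    invariant that tells most edges of the snake apart. *)
Definition level (e : edge) : nat := e.1.1 + e.1.2.
Definition vertical (e : edge) : bool := e.1.1 == e.2.1.

Section Ladder.
Variables (s : nat -> bool) (d : nat).

(** Twisting by the parity of k makes the whole local geometry below depend only
    on whether s_k equals b; the two values of b are then interchangeable, and
    one proof serves both corners of a tile. *)
Definition lo (b : bool) (k : nat) : edge :=
  if odd k (+) b then west (tile_at s k) else south (tile_at s k).
Definition hi (b : bool) (k : nat) : edge :=
  if odd k (+) b then east (tile_at s k) else north (tile_at s k).
Definition corner (b : bool) (k : nat) : point :=
  let: (x, y) := tile_at s k in if odd k (+) b then (x, y.+1) else (x.+1, y).

(** For each k exactly one b qualifies: this is the edge shared by the tiles k
    and k+1. *)
Lemma hi_lo b k : s k.+1 != b -> hi b k = lo (~~ b) k.+1.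
Proof.
rewrite /hi /lo /= addbN addNb negbK.
by case: (tile_at s k) => x y; case: b; case: (s k.+1); case: (odd k).
Qed.

Lemma level_lo b k : level (lo b k) = k.
Proof. by rewrite /level /lo -[RHS](tile_at_level s); case: ifP. Qed.

Lemma level_hi b k : level (hi b k) = k.+1.
Proof.
rewrite /level /hi -[in RHS](tile_at_level s k).
by case: ifP => _ /=; rewrite ?addnS ?addSn.
Qed.

Lemma vertical_lo b k : vertical (lo b k) = odd k (+) b.
Proof. by rewrite /vertical /lo; case: ifP => _ /=; rewrite ?eqxx // ltn_eqF. Qed.

Lemma vertical_hi b k : vertical (hi b k) = odd k (+) b.
Proof. by rewrite /vertical /hi; case: ifP => _ /=; rewrite ?eqxx // ltn_eqF. Qed.

Let eqnS n : (n == n.+1) = false. Proof. by rewrite ltn_eqF. Qed.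
Let eqSn n : (n.+1 == n) = false. Proof. by rewrite gtn_eqF. Qed.
Let eqnSS n : (n == n.+2) = false. Proof. by rewrite ltn_eqF. Qed.
Let eqSSn n : (n.+2 == n) = false. Proof. by rewrite gtn_eqF. Qed.
Let neS := (eqxx, eqnS, eqSn, eqnSS, eqSSn, andbF, andbT, orbF).

Lemma incid_lo b b' k : incid (corner b k) (lo b' k) = (b' == b).
Proof.
rewrite /incid /corner /lo; case: (tile_at s k) => x y.
by case: b; case: b'; case: (odd k); rewrite /= !xpair_eqE /= !neS.
Qed.

Lemma incid_hi b b' k : incid (corner b k) (hi b' k) = (b' != b).
Proof.
rewrite /incid /corner /hi; case: (tile_at s k) => x y.
by case: b; case: b'; case: (odd k); rewrite /= !xpair_eqE /= !neS.
Qed.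

(** The sign s_(k+1) = b says that the snake turns so that [corner b k] is the
    lower left vertex of tile k+1. *)
Lemma incid_lo_next b b' k :
  incid (corner b k) (lo b' k.+1) = (s k.+1 == b).
Proof.
rewrite /incid /corner /lo /=; case: (tile_at s k) => x y.
by case: b; case: b'; case: (odd k); case: (s k.+1);
  rewrite /= !xpair_eqE /= !neS.
Qed.

(** Dually, it says that [corner b k.+1] is the upper right vertex of tile k. *)
Lemma incid_hi_prev b b' k :
  incid (corner b k.+1) (hi b' k) = (s k.+1 == b).
Proof.
rewrite /incid /corner /hi /=; case: (tile_at s k) => x y.
by case: b; case: b'; case: (odd k); case: (s k.+1);
  rewrite /= !xpair_eqE /= !neS.
Qed.

Lemma tile_edgesP e k :
  reflect (exists b, e = lo b k \/ e = hi b k)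
    (e \in tile_edges (tile_at s k)).
Proof.
rewrite /lo /hi !inE; apply: (iffP or4P) => [|[b]].
  case=> /eqP->; [exists (odd k)|exists (odd k)|exists (~~ odd k)|exists (~~ odd k)];
    by rewrite ?addbN addbb; auto.
by case: (odd k (+) b) => -[]->; rewrite eqxx; [exact: Or43|exact: Or44|exact: Or41|exact: Or42].
Qed.

Lemma corner_level b k : (corner b k).1 + (corner b k).2 = k.+1.
Proof.
rewrite /corner -[in RHS](tile_at_level s k); case: (tile_at s k) => x y.
by case: ifP => _ /=; rewrite ?addnS ?addSn.
Qed.

Lemma incid_lo_level v b k : incid v (lo b k) -> k <= v.1 + v.2 <= k.+1.
Proof.
rewrite /incid /lo -[in _ <= _ <= _](tile_at_level s k).
by case: (tile_at s k) => x y; case: ifP => _ /orP[] /eqP-> /=; lia.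
Qed.

Lemma incid_hi_level v b k : incid v (hi b k) -> k < v.1 + v.2 <= k.+2.
Proof.
rewrite /incid /hi -[in _ < _ <= _](tile_at_level s k).
by case: (tile_at s k) => x y; case: ifP => _ /orP[] /eqP-> /=; lia.
Qed.

Variable E : seq edge.
Hypothesis mem_E : forall e,
  reflect (exists2 k, k < d & e \in tile_edges (tile_at s k)) (e \in E).

(** The two edges of tile k at this corner come first; each neighbouring tile
    adds one edge if this corner is its upper right (tile k-1) or lower left
    (tile k+1) vertex. The other edge of that neighbour at the corner is the
    shared one, hence is already in the list. *)
Lemma incident_corner b k : k < d ->
  perm_eq [seq e <- undup E | incid (corner b k) e]
    ([:: lo b k; hi (~~ b) k]
     ++ (if (0 < k) && (s k == b) then [:: hi b k.-1] else [::])
     ++ (if (k.+1 < d) && (s k.+1 == b) then [:: lo (~~ b) k.+1] else [::])).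
Proof.
move=> ltkd; apply: uniq_perm.
- by rewrite filter_uniq // undup_uniq.
- have ne e e' : (level e != level e') || (vertical e != vertical e') ->
    (e == e') = false by apply: contraTF => /eqP->; rewrite !eqxx.
  case: k ltkd => [|j] _ /=; first case: ifP => _.
  - rewrite /= !inE !ne // ?level_lo ?level_hi ?vertical_lo ?vertical_hi //=;
    by case: b.
  - rewrite /= !inE !ne // ?level_lo ?level_hi ?vertical_lo ?vertical_hi //=;
    by case: b.
  case: ifP => _; case: ifP => _;
  rewrite /= !inE !ne // ?level_lo ?level_hi ?vertical_lo ?vertical_hi ?neS //=;
    by case: b; case: odd.
move=> e; rewrite mem_filter mem_undup; apply/andP/idP.
  case=> inc /mem_E[j ltjd /tile_edgesP[b' [] eE]].
    rewrite {e}eE in inc *.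
    have := incid_lo_level inc; rewrite corner_level => lev.
    have {lev} [jE|jE] : j = k \/ j = k.+1 by lia.
      by rewrite {j}jE in inc ltjd *; rewrite incid_lo in inc; rewrite (eqP inc) mem_head.
    rewrite {j}jE in inc ltjd *; rewrite incid_lo_next in inc.
    rewrite inc ltjd !mem_cat [in X in [|| _, _ | X]]inE.
    case: (eqVneq b' (~~ b)) => [->|neb]; first by rewrite eqxx !orbT.
    have -> : b' = ~~ ~~ b by case: (b) neb; case: (b').
    by rewrite -hi_lo ?(eqP inc) ?inE ?eqxx ?orbT //; case: (b).
  rewrite {e}eE in inc *.
  have := incid_hi_level inc; rewrite corner_level => lev.
  have {lev} [jE|jE] : j = k \/ k = j.+1 by lia.
    rewrite {j}jE in inc ltjd *; rewrite incid_hi in inc.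
    have -> : b' = ~~ b by case: (b) inc; case: (b').
    by rewrite !inE eqxx orbT.
  rewrite {k}jE in inc ltkd *; rewrite incid_hi_prev in inc.
  rewrite inc /=.
  case: (eqVneq b' b) => [->|neb]; first by rewrite !inE eqxx !orbT.
  have -> : b' = ~~ b by case: (b) neb; case: (b').
  by rewrite hi_lo ?negbK ?inE ?eqxx // (eqP inc); case: (b).
have in_lo b' j : j < d -> lo b' j \in E.
  by move=> ltj; apply/mem_E; exists j => //; apply/tile_edgesP; exists b'; left.
have in_hi b' j : j < d -> hi b' j \in E.
  by move=> ltj; apply/mem_E; exists j => //; apply/tile_edgesP; exists b'; right.
rewrite !mem_cat => /or3P[].
- rewrite !inE => /orP[] /eqP->; rewrite ?incid_lo ?incid_hi ?eqxx ?in_lo ?in_hi //.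
  by case: b.
- case: k ltkd => //= j ltj; case: eqP => //= sj; rewrite inE => /eqP->.
  by rewrite incid_hi_prev sj eqxx in_hi // ltnW.
- case: ifP => // /andP[ltk sk]; rewrite inE => /eqP->.
  by rewrite incid_lo_next sk in_lo.
Qed.

Lemma incident_origin : 0 < d ->
  perm_eq [seq e <- undup E | incid (0, 0) e] [:: lo false 0; lo true 0].
Proof.
move=> d0; apply: uniq_perm => //; first by rewrite filter_uniq // undup_uniq.
move=> e; rewrite mem_filter mem_undup; apply/andP/idP.
  case=> inc /mem_E[j ltjd /tile_edgesP[b [] eE]]; rewrite {e}eE in inc *.
    have := incid_lo_level inc; rewrite leqn0 => /andP[/eqP-> _].
    by case: b {inc}; rewrite !inE eqxx ?orbT.
  by have := incid_hi_level inc.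
rewrite !inE => eE; split; first by case/orP: eE => /eqP->.
apply/mem_E; exists 0 => //; apply/tile_edgesP.
by case/orP: eE => /eqP->; [exists false|exists true]; left.
Qed.

Definition apex (k : nat) : point :=
  let: (x, y) := tile_at s k in (x.+1, y.+1).

Lemma apex_level k : (apex k).1 + (apex k).2 = k.+2.
Proof.
rewrite /apex -[in RHS](tile_at_level s k); case: (tile_at s k) => x y /=.
by rewrite addnS addSn.
Qed.

Lemma incid_apex b k : incid (apex k) (hi b k).
Proof.
by rewrite /incid /apex /hi; case: (tile_at s k) => x y; case: ifP => _;
  rewrite eqxx orbT.
Qed.

Lemma incident_apex : 0 < d ->
  perm_eq [seq e <- undup E | incid (apex d.-1) e]
    [:: hi false d.-1; hi true d.-1].
Proof.
case: d mem_E => // d' memE _; apply: uniq_perm => //=.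
- by rewrite filter_uniq // undup_uniq.
- rewrite inE andbT; apply/eqP => /(congr1 vertical).
  by rewrite !vertical_hi; case: (odd d').
move=> e; rewrite mem_filter mem_undup; apply/andP/idP.
  case=> inc /memE[j ltjd /tile_edgesP[b [] eE]]; rewrite {e}eE in inc *.
    by have := incid_lo_level inc; rewrite apex_level; lia.
  have := incid_hi_level inc; rewrite apex_level => lev.
  have {lev inc} -> : j = d' by lia.
  by case: b; rewrite !inE eqxx ?orbT.
rewrite !inE => eE; split; first by case/orP: eE => /eqP->; exact: incid_apex.
apply/memE; exists d' => //; apply/tile_edgesP.
by case/orP: eE => /eqP->; [exists false|exists true]; right.
Qed.

Lemma tile_at_corner k : tile_at s k.+1 = corner (s k.+1) k.
Proof.
rewrite /corner /=; case: (tile_at s k) => x y /=.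
by case: (s k.+1); case: (odd k).
Qed.

Lemma apex_corner k : apex k = corner (s k.+1) k.+1.
Proof.
rewrite /apex /corner /=; case: (tile_at s k) => x y /=.
by case: (s k.+1); case: (odd k).
Qed.

Lemma vertexP v e : e \in E -> incid v e ->
  [\/ v = (0, 0), v = apex d.-1 | exists b k, k < d /\ v = corner b k].
Proof.
move=> /mem_E[k ltkd /tile_edgesP[b [] ->]].
  have -> : incid v (lo b k) = (v == tile_at s k) || (v == corner b k).
    by rewrite /incid /lo /corner; case: (tile_at s k) => x y; case: ifP.
  case/orP=> /eqP->; last by apply: Or33; exists b, k.
  case: k ltkd => [|k] ltkd; first exact: Or31.
  by apply: Or33; exists (s k.+1), k; rewrite (ltnW ltkd) tile_at_corner.
have -> : incid v (hi b k) = (v == apex k) || (v == corner (~~ b) k).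
  rewrite /incid /hi /corner /apex; case: (tile_at s k) => x y.
  by rewrite addbN orbC; case: (_ (+) _).
case/orP=> /eqP->; last by apply: Or33; exists (~~ b), k.
case: (ltnP k.+1 d) => [ltk|ledk]; last by apply: Or32; congr apex; lia.
by apply: Or33; exists (s k.+1), k.+1; rewrite apex_corner.
Qed.
End Ladder.

(** * Flows on the ladder of antidiagonals *)

Section Balance.
Variables (m d : nat) (s : nat -> bool) (L U : bool -> nat -> nat).

Definition inflow b k := L b k + (if (0 < k) && (s k == b) then U b k.-1 else 0).
Definition outflow b k :=
  U (~~ b) k + (if (k.+1 < d) && (s k.+1 == b) then L (~~ b) k.+1 else 0).

(** The conditions for multiplicities L on the edges [lo] and U on the edges [hi]
    to form an m-dimer cover: the degrees at the first vertex, at the last one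
    and at the corners, and the agreement of L and U on shared edges. *)
Definition balanced :=
  [/\ inflow false 0 + inflow true 0 = m,
      U false d.-1 + U true d.-1 = m,
      forall b k, k < d -> inflow b k + outflow b k = m
    & forall b k, k.+1 < d -> s k.+1 != b -> U b k = L (~~ b) k.+1].

Hypothesis bal : balanced.

(** Summing the two degree conditions of tile k: its corners pass 2m - m = m
    units on to the next antidiagonal. *)
Lemma inflow_total k : k < d -> inflow false k + inflow true k = m.
Proof.
case: bal => bal0 _ balk shared.
elim: k => // k IH ltk; have := IH (ltnW ltk).
have := balk false k (ltnW ltk); have := balk true k (ltnW ltk).
have := shared (~~ s k.+1) k ltk; rewrite /outflow /inflow ltk /=.
case: (s k.+1) => /= /(_ isT); lia.
Qed.

(** The difference of the two inflows is the multiplicity of the edge shared by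
    the tiles k and k+1. *)
Lemma inflow_mono k : k.+1 < d ->
  inflow (s k.+1) k <= inflow (s k.+1) k.+1.
Proof.
case: bal => _ _ balk shared ltk.
have := inflow_total (ltnW ltk).
have := balk (~~ s k.+1) k (ltnW ltk); have := shared (~~ s k.+1) k ltk.
rewrite /outflow /inflow ltk /=.
case: (s k.+1) => /= /(_ isT); lia.
Qed.

(** Together with [hi_inflow], this recovers the cover from its inflows. *)
Lemma lo_inflow b k : k < d ->
  L b k = inflow b k - (if (0 < k) && (s k == b) then inflow b k.-1 else 0).
Proof.
case: bal => _ _ balk shared ltk.
case: ifP => [|skb]; last by rewrite /inflow skb addn0 subn0.
case: k ltk => //= k ltk /eqP skb.
have := inflow_total (ltnW ltk).
have := balk (~~ b) k (ltnW ltk); have := shared (~~ b) k ltk.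
by rewrite /outflow /inflow ltk skb /= negbK; case: (b) => /= /(_ isT); lia.
Qed.

Lemma hi_inflow b k : k < d ->
  U b k = inflow b k - (if (k.+1 < d) && (s k.+1 != b) then inflow b k.+1 else 0).
Proof.
case: bal => _ bald balk shared ltk.
have := inflow_total ltk; have := balk (~~ b) k ltk.
case: (ltnP k.+1 d) => [ltk1|led] /=.
  have := inflow_total ltk1; have := balk b k ltk.
  have := shared b k ltk1.
  rewrite /outflow /inflow ltk1 /=.
  by case: (s k.+1); case: (b) => /=; try move/(_ isT); lia.
by rewrite /outflow ltnNge led /= negbK; case: (b) => /=; lia.
Qed.
End Balance.

Section FromHeights.
Variables (m d : nat) (s : nat -> bool) (h : nat -> nat).
Hypothesis h_le : forall k, k < d -> h k <= m.
Hypothesis h_mono : forall k, k.+1 < d ->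
  if s k.+1 then h k.+1 <= h k else h k <= h k.+1.

(** The inflow at [corner b k] when the one at [corner false k] is h_k. *)
Definition side b k := if b then m - h k else h k.
Definition lo_val b k :=
  side b k - (if (0 < k) && (s k == b) then side b k.-1 else 0).
Definition hi_val b k :=
  side b k - (if (k.+1 < d) && (s k.+1 != b) then side b k.+1 else 0).

Lemma hi_lo_val b k : k.+1 < d -> s k.+1 != b ->
  hi_val b k = lo_val (~~ b) k.+1.
Proof.
move=> ltk; rewrite /hi_val /lo_val /side ltk.
have := h_le ltk; have := h_le (ltnW ltk); have := h_mono ltk.
by case: (s k.+1); case: b => //=; lia.
Qed.

Lemma inflow_val b k : k < d -> inflow s lo_val hi_val b k = side b k.
Proof.
rewrite /inflow; case: k => [|k] ltk; first by rewrite addn0 /lo_val subn0.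
rewrite /lo_val /hi_val ltk /=.
have := h_le ltk; have := h_le (ltnW ltk); have := h_mono ltk.
by rewrite /side; case: (s k.+1); case: b => //=; lia.
Qed.

(** Converse of [lo_inflow] and [hi_inflow]: any heights with the prescribed
    monotonicity come from a cover. *)
Lemma balanced_val : 0 < d -> balanced m d s lo_val hi_val.
Proof.
move=> d0; split.
- by rewrite !inflow_val // /side subnKC ?h_le.
- rewrite /hi_val (prednK d0) ltnn /= !subn0 /side subnKC // h_le //.
  by rewrite prednK.
- move=> b k ltk; rewrite inflow_val // /outflow.
  case: (ltnP k.+1 d) => [ltk1|led] /=.
    rewrite /lo_val /hi_val ltk1 /= /side.
    have := h_le ltk; have := h_le ltk1; have := h_mono ltk1.
    by case: (s k.+1); case: b => //=; lia.
  rewrite /hi_val ltnNge led /= /side; have := h_le ltk.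
  by case: b => /=; lia.
- by move=> b k; exact: hi_lo_val.
Qed.
End FromHeights.

Section EdgeVal.
Variables (m d : nat) (s : nat -> bool) (h : nat -> nat).
Hypothesis h_le : forall k, k < d -> h k <= m.
Hypothesis h_mono : forall k, k.+1 < d ->
  if s k.+1 then h k.+1 <= h k else h k <= h k.+1.

(** The multiplicities [lo_val] and [hi_val] as one function of the edge. The
    index b and the tile are read off from the level and the direction; an edge
    that is not a [lo] edge of its level is a [hi] edge of the tile before. *)
Definition edge_val (e : edge) : nat :=
  let k := level e in
  let b := odd k (+) vertical e in
  if (k < d) && (e == lo s b k) then lo_val m s h b k
  else hi_val m d s h (~~ b) k.-1.

Lemma edge_val_lo b k : k < d -> edge_val (lo s b k) = lo_val m s h b k.
Proof.
by move=> ltk; rewrite /edge_val level_lo vertical_lo addKb ltk eqxx.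
Qed.

Lemma edge_val_hi b k : k < d -> edge_val (hi s b k) = hi_val m d s h b k.
Proof.
move=> ltk; rewrite /edge_val level_hi vertical_hi /= addNb addKb negbK; case: ifP => // /andP[ltk1 /eqP hi_eq].
rewrite hi_lo_val //; apply/eqP => sk.
have := incid_hi s b b k.
by rewrite hi_eq incid_lo_next sk !eqxx.
Qed.

End EdgeVal.

(** * Dimer covers as weights on lattice edges *)

Section Covers.
Variable ts : seq point.
Notation E := (snake_edges ts).

Lemma sum_seq_sub (F : edge -> nat) (P : pred edge) :
  \sum_(e : seq_sub E | P (val e)) F (val e) = \sum_(e <- undup E | P e) F e.
Proof.
rewrite -(big_map val P F); apply/perm_big/uniq_perm.
- by rewrite map_inj_uniq ?index_enum_uniq //; exact: val_inj.
- exact: undup_uniq.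
move=> e; rewrite mem_undup; apply/mapP/idP => [[e' _ ->]|eE]; first exact: ssvalP.
by exists (SeqSub eE); rewrite ?mem_index_enum.
Qed.

Definition degree (F : edge -> nat) (v : point) :=
  \sum_(e <- undup E | incid v e) F e.

Lemma degree_perm F v es :
  perm_eq [seq e <- undup E | incid v e] es -> degree F v = \sum_(e <- es) F e.
Proof. by move=> p; rewrite /degree -big_filter (perm_big _ p). Qed.

Definition extend m (g : {ffun gedge (snake_graph ts) -> 'I_m.+1}) (e : edge) : nat :=
  if insub e is Some e' then g e' else 0.

Lemma extend_val m g e : @extend m g (val e) = g e.
Proof. by rewrite /extend valK. Qed.

Lemma extend_inj m g g' :
  (forall e, e \in E -> @extend m g e = extend g' e) -> g = g'.
Proof.
move=> eq_gg'; apply/ffunP => e; apply: val_inj.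
by rewrite /= -!extend_val eq_gg' ?ssvalP.
Qed.

Lemma mem_snake_vertices v :
  reflect (exists2 e, e \in E & incid v e) (v \in snake_vertices ts).
Proof.
apply: (iffP flatten_mapP) => -[e eE inc]; exists e => //.
  by rewrite !inE in inc.
by rewrite !inE.
Qed.

Lemma OmegaP m (g : {ffun gedge (snake_graph ts) -> 'I_m.+1}) :
  reflect (forall v e, e \in E -> incid v e -> degree (extend g) v = m)
    (g \in Omega m (snake_graph ts)).
Proof.
have dE (v : vertex (snake_graph ts)) :
    \sum_(e : gedge (snake_graph ts) | incident v e) (g e : nat)
    = degree (extend g) (val v).
  by rewrite /degree -sum_seq_sub; apply: eq_bigr => e _; rewrite extend_val.
rewrite inE; apply: (iffP forallP) => [cov v e eE inc | deg v].
  have vV : v \in snake_vertices ts by apply/mem_snake_vertices; exists e.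
  by have /eqP := cov (SeqSub vV); rewrite dE.
rewrite dE; apply/eqP.
by have /mem_snake_vertices[e eE inc] := ssvalP v; exact: deg inc.
Qed.
End Covers.

(** * Walks *)

Definition step (t : bool) (i j : nat) : bool := if t then j <= i else i <= j.

Definition steps (m : nat) (t : bool) (i : nat) : seq nat :=
  [seq j <- iota 0 m.+1 | step t i j].

Lemma mem_steps m t i j : (j \in steps m t i) = (j <= m) && step t i j.
Proof. by rewrite mem_filter mem_iota andbC. Qed.

(** Walks are listed without their starting point i, as sequences, so that the
    bijection with covers is an equality of duplicate-free lists up to order. *)
Fixpoint walks (m i : nat) (ss : seq bool) : seq (seq nat) :=
  if ss is t :: ss' then
    [seq j :: w | j <- steps m t i, w <- walks m j ss']
  else [:: [::]].

Lemma uniq_walks m i ss : uniq (walks m i ss).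
Proof.
elim: ss i => //= t ss IH i.
apply: allpairs_uniq_dep => [|j _|].
- exact: (filter_uniq _ (iota_uniq _ _)).
- exact: IH.
by move=> [x y] [x' y'] _ _ /= [-> ->].
Qed.

Lemma mem_walks m i ss w :
  reflect (size w = size ss /\ forall k, k < size ss ->
      nth 0 w k <= m /\ step (nth false ss k) (nth 0 (i :: w) k) (nth 0 w k))
    (w \in walks m i ss).
Proof.
elim: ss i w => [|t ss IH] i w /=.
  by rewrite inE; apply: (iffP eqP) => [->|[/size0nil]].
apply: (iffP allpairsPdep) => [[j [w' [jI w'W ->]]]|[]].
  move: jI; rewrite mem_steps => /andP[lej tij].
  have [sz stp] := IH _ _ w'W.
  by rewrite /= sz; split=> // -[|k] //=; exact: stp.
case: w => [//|j w] /= [sz] stp.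
exists j, w; split=> //.
  by rewrite mem_steps; have [/= -> ->] := stp 0 isT.
by apply/IH; split=> // k ltk; exact: (stp k.+1).
Qed.

(** * Dimer covers are walks *)

Section CardOmega.
Variables (m : nat) (ss : seq bool).
Hypothesis ss0 : nth false ss 0 = false.
Notation d := (size ss).
Notation s := (nth false ss).
Notation ts := (mkseq (tile_at s) d).
Hypothesis d_gt0 : 0 < d.

Lemma mem_snake_edges e :
  reflect (exists2 k, k < d & e \in tile_edges (tile_at s k)) (e \in snake_edges ts).
Proof.
have -> : snake_edges ts = flatten (map tile_edges ts).
  by rewrite /snake_edges; case: (size ss) d_gt0.
apply: (iffP flatten_mapP) => [[t /mapP[k]]|[k ltk ek]].
  by rewrite mem_iota => /andP[_ ltk] -> ek; exists k.
by exists (tile_at s k) => //; apply: map_f; rewrite mem_iota.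
Qed.

Let lo_weight F b k : nat := F (lo s b k).
Let hi_weight F b k : nat := F (hi s b k).

Lemma degree_corner F b k : k < d ->
  degree ts F (corner s b k) =
  inflow s (lo_weight F) (hi_weight F) b k + outflow d s (lo_weight F) (hi_weight F) b k.
Proof.
move=> ltk; rewrite (degree_perm _ (incident_corner mem_snake_edges b ltk)).
rewrite /inflow /outflow /lo_weight /hi_weight /= !big_cons big_cat /=.
by case: ifP => _; case: ifP => _; rewrite ?big_seq1 ?big_nil; lia.
Qed.

(** The vertices of the snake graph are its first and last vertex and the
    corners, so the conditions of [balanced] are the degree conditions. *)
Lemma degree_balanced F :
  (forall v e, e \in snake_edges ts -> incid v e -> degree ts F v = m) <->
  balanced m d s (lo_weight F) (hi_weight F).
Proof.
have deg0 := degree_perm F (incident_origin mem_snake_edges d_gt0).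
have degd := degree_perm F (incident_apex mem_snake_edges d_gt0).
rewrite !big_cons !big_nil !addn0 in deg0 degd.
have in_lo b k : k < d -> lo s b k \in snake_edges ts.
  move=> ltk; apply/mem_snake_edges; exists k => //.
  by apply/tile_edgesP; exists b; left.
have in_hi b k : k < d -> hi s b k \in snake_edges ts.
  move=> ltk; apply/mem_snake_edges; exists k => //.
  by apply/tile_edgesP; exists b; right.
split=> [deg|[bal0 bald balk _] v e eE inc].
  split.
  - by rewrite /inflow !addn0 -deg0 (deg _ (lo s false 0)) // in_lo.
  - rewrite -degd (deg _ (hi s false d.-1)) ?incid_apex // in_hi //.
    by rewrite prednK.
  - move=> b k ltk; rewrite -degree_corner // (deg _ (lo s b k)) ?in_lo //.
    by rewrite incid_lo.
  - by move=> b k _ sk; rewrite /hi_weight hi_lo.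
case: (vertexP mem_snake_edges eE inc) => [->|->|[b [k [ltk ->]]]].
- by rewrite deg0 -bal0 /inflow !addn0.
- by rewrite degd.
- by rewrite degree_corner // balk.
Qed.

Definition heights (F : edge -> nat) : seq nat :=
  mkseq (inflow s (lo_weight F) (hi_weight F) false) d.

Lemma heights_val F k : balanced m d s (lo_weight F) (hi_weight F) -> k < d ->
  forall b, inflow s (lo_weight F) (hi_weight F) b k = side m (nth 0 (heights F)) b k.
Proof.
move=> bal ltk b; have := inflow_total bal ltk.
by rewrite /side nth_mkseq //; case: b => //; lia.
Qed.

Lemma lo_heights F b k : balanced m d s (lo_weight F) (hi_weight F) -> k < d ->
  F (lo s b k) = lo_val m s (nth 0 (heights F)) b k.
Proof.
move=> bal ltk; rewrite -[LHS]/(lo_weight F b k) (lo_inflow bal) // /lo_val.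
by rewrite !heights_val // (leq_ltn_trans (leq_pred k)).
Qed.

Lemma hi_heights F b k : balanced m d s (lo_weight F) (hi_weight F) -> k < d ->
  F (hi s b k) = hi_val m d s (nth 0 (heights F)) b k.
Proof.
move=> bal ltk; rewrite -[LHS]/(hi_weight F b k) (hi_inflow bal) // /hi_val.
by rewrite heights_val //; case: ifP => // /andP[ltk1 _]; rewrite heights_val.
Qed.

Lemma heights_inj F F' e :
  balanced m d s (lo_weight F) (hi_weight F) -> balanced m d s (lo_weight F') (hi_weight F') ->
  heights F = heights F' -> e \in snake_edges ts -> F e = F' e.
Proof.
move=> bal bal' eq_h /mem_snake_edges[k ltk /tile_edgesP[b [] ->]].
  by rewrite !lo_heights ?eq_h.
by rewrite !hi_heights ?eq_h.
Qed.

Lemma heights_walk F : balanced m d s (lo_weight F) (hi_weight F) ->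
  heights F \in walks m 0 ss.
Proof.
move=> bal; apply/mem_walks; rewrite size_mkseq; split=> // k ltk.
split; first by rewrite nth_mkseq // -(inflow_total bal ltk) leq_addr.
case: k ltk => [|k] ltk; first by rewrite ss0.
have := inflow_mono bal ltk.
have := inflow_total bal ltk; have := inflow_total bal (ltnW ltk).
rewrite !heights_val ?(ltnW ltk) // /side /step [nth 0 (0 :: _) _]/=.
by case: (s k.+1); lia.
Qed.

Section WalkCover.
Variable w : seq nat.
Hypothesis walk_w : w \in walks m 0 ss.
Notation h := (nth 0 w).

Lemma walk_le k : k < d -> h k <= m.
Proof. by have [_ stp] := mem_walks _ _ _ _ walk_w => /stp[]. Qed.

Lemma walk_mono k : k.+1 < d -> if s k.+1 then h k.+1 <= h k else h k <= h k.+1.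
Proof.
have [_ stp] := mem_walks _ _ _ _ walk_w => /stp[_].
by rewrite /step /=; case: (s k.+1).
Qed.

(** The inverse of [heights]. *)
Definition walk_cover : {ffun gedge (snake_graph ts) -> 'I_m.+1} :=
  [ffun e => inord (edge_val m d s h (val e))].

Lemma side_le b k : k < d -> side m h b k <= m.
Proof. by move=> ltk; rewrite /side; case: b; rewrite ?leq_subr ?walk_le. Qed.

Lemma extend_walk_cover e : e \in snake_edges ts ->
  extend walk_cover e = edge_val m d s h e.
Proof.
move=> eE; rewrite -[e in LHS]/(val (SeqSub eE)) extend_val ffunE inordK //= ltnS.
case/mem_snake_edges: eE => k ltk /tile_edgesP[b [] ->].
  by rewrite edge_val_lo // (leq_trans (leq_subr _ _)) ?side_le.
rewrite edge_val_hi //; [|exact: walk_le|exact: walk_mono].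
by rewrite (leq_trans (leq_subr _ _)) ?side_le.
Qed.

Lemma extend_walk_lo b k : k < d ->
  extend walk_cover (lo s b k) = lo_val m s h b k.
Proof.
move=> ltk; rewrite extend_walk_cover ?edge_val_lo //.
by apply/mem_snake_edges; exists k => //; apply/tile_edgesP; exists b; left.
Qed.

Lemma extend_walk_hi b k : k < d ->
  extend walk_cover (hi s b k) = hi_val m d s h b k.
Proof.
move=> ltk; rewrite extend_walk_cover.
  by apply: edge_val_hi => //; [exact: walk_le|exact: walk_mono].
by apply/mem_snake_edges; exists k => //; apply/tile_edgesP; exists b; right.
Qed.

Lemma inflow_walk b k : k < d ->
  inflow s (lo_weight (extend walk_cover)) (hi_weight (extend walk_cover)) b k = side m h b k.
Proof.
move=> ltk; rewrite -(inflow_val walk_le walk_mono) // /inflow /lo_weight /hi_weight.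
by rewrite extend_walk_lo // extend_walk_hi // (leq_ltn_trans (leq_pred k)).
Qed.

Lemma balanced_walk_cover :
  balanced m d s (lo_weight (extend walk_cover)) (hi_weight (extend walk_cover)).
Proof.
have [bal0 bald balk shared] := balanced_val walk_le walk_mono d_gt0.
have d1 : d.-1 < d by rewrite prednK.
split.
- by rewrite !inflow_walk // /side subnKC // walk_le.
- by rewrite /hi_weight !extend_walk_hi.
- move=> b k ltk; apply: etrans (balk b k ltk).
  rewrite inflow_walk // (inflow_val walk_le walk_mono) //.
  rewrite /outflow /hi_weight /lo_weight extend_walk_hi //; congr (_ + (_ + _)).
  by case: ifP => // /andP[ltk1 _]; exact: extend_walk_lo.
- by move=> b k ltk sk; rewrite /hi_weight hi_lo.
Qed.

Lemma heights_walk_cover : heights (extend walk_cover) = w.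
Proof.
have [sz _] := mem_walks _ _ _ _ walk_w.
apply: (@eq_from_nth _ 0); rewrite size_mkseq ?sz // => k ltk.
by rewrite nth_mkseq // inflow_walk.
Qed.
End WalkCover.

Lemma card_Omega_walks : #|Omega m (snake_graph ts)| = size (walks m 0 ss).
Proof.
rewrite cardE -(size_map (fun g => heights (extend g))).
apply/perm_size/uniq_perm.
- rewrite map_inj_in_uniq ?enum_uniq // => g g'; rewrite !mem_enum.
  move=> /OmegaP/degree_balanced bal /OmegaP/degree_balanced bal' eq_h.
  by apply: extend_inj => e; exact: heights_inj.
- exact: uniq_walks.
move=> w; apply/mapP/idP => [[g]|walk_w].
  by rewrite mem_enum => /OmegaP/degree_balanced bal ->; exact: heights_walk.
exists (walk_cover w); last by rewrite heights_walk_cover.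
by rewrite mem_enum; apply/OmegaP/degree_balanced/balanced_walk_cover.
Qed.
End CardOmega.

Lemma size_walks_cons m i t ss :
  size (walks m i (t :: ss)) =
  \sum_(j < m.+1 | step t i j) size (walks m j ss).
Proof.
rewrite /= size_allpairs_dep sumnE big_map big_filter.
by rewrite -(big_mkord (step t i) (fun j => size (walks m j ss))) /index_iota subn0.
Qed.

Lemma cf_tile_at a ss k :
  (forall j, j <= k -> nth false (sign_seq a) j = nth false ss j) ->
  nth false ss 0 = false -> cf_tile a k = tile_at (nth false ss) k.
Proof.
move=> eq_s ss0; elim: k eq_s => //= k IH eq_s.
rewrite IH => [|j lej]; last by rewrite eq_s // leqW.
by rewrite eq_s // (eq_s 0) // ss0.
Qed.

Lemma size_signs_from s a : size (signs_from s a) = sumn a.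
Proof. by elim: a s => //= x a IH s; rewrite size_cat size_nseq IH. Qed.

(** * Products of the matrices Lambda *)

Local Open Scope ring_scope.

Lemma bracket_neg x k : k < 0 -> bracket x k = 0.
Proof. by case: k. Qed.

(** [bracket 0 k] is 1 for k = 0 and 0 otherwise, so Lambda(0) is the
    reflection. Blocks of size 0 serve as the base of the induction on the
    first entry. *)
Lemma Lambda0 m (i j : 'I_m.+1) : Lambda m 0 i j = (j == rev_ord i)%:R.
Proof.
have [lei lej] := (ltn_ord i, ltn_ord j).
have [->|ne] := eqVneq j (rev_ord i).
  rewrite mxE; have -> : m%:Z - i%:Z - (rev_ord i)%:Z = 0 by rewrite /=; lia.
  by [].
have {}ne : (i + j)%N != m by apply: contraNneq ne => E; apply/eqP/val_inj => /=; lia.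
rewrite mxE; case E: (_ - _) => [[|k]|k] //=; first by exfalso; lia.
by rewrite bin_small // add0n.
Qed.

Lemma bracket_pascal x n : bracket x.+1 n = bracket x n + bracket x.+1 (n - 1).
Proof.
case: n => [[|k]|k]; [by rewrite /= !bin0 addr0| |by rewrite !bracket_neg ?addr0].
have -> : k.+1%:Z - 1 = k%:Z by lia.
by rewrite /= addnS /= -natrD binS.
Qed.

(** Iterated Pascal rule: Lambda(x+1) is the matrix of weak up-steps times
    Lambda(x). *)
Lemma LambdaS m x (i j : 'I_m.+1) :
  Lambda m x.+1 i j = \sum_(k < m.+1 | (i <= k)%N) Lambda m x k j.
Proof.
have sumE n (l : nat) : (l + n)%N = m.+1 ->
    bracket x.+1 (m%:Z - l%:Z - j%:Z) =
    \sum_(l <= k < m.+1) bracket x (m%:Z - k%:Z - j%:Z).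
  elim: n l => [|n IH] l ln; first by rewrite big_geq ?bracket_neg //; lia.
  rewrite big_ltn; last by lia.
  rewrite -IH; last by lia.
  by rewrite bracket_pascal; congr (_ + bracket _ _); lia.
rewrite mxE (sumE (m.+1 - i)%N) ?subnKC //; last exact: ltnW.
rewrite big_geq_mkord; apply: eq_bigr => k _.
by rewrite mxE.
Qed.

Lemma prod_Lambda0 m a i :
  (\prod_(x <- 0%N :: a) Lambda m x) i ord0 =
  (\prod_(x <- a) Lambda m x) (rev_ord i) ord0.
Proof.
rewrite big_cons mxE (bigD1 (rev_ord i)) //= Lambda0 eqxx mul1r.
by rewrite [X in _ + X]big1 ?addr0 // => j /negPf ne; rewrite Lambda0 ne mul0r.
Qed.

Lemma prod_LambdaS m x a i :
  (\prod_(x <- x.+1 :: a) Lambda m x) i ord0 =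
  \sum_(j < m.+1 | (i <= j)%N) (\prod_(x <- x :: a) Lambda m x) j ord0.
Proof.
rewrite big_cons mxE.
under [LHS]eq_bigr => j _ do rewrite LambdaS mulr_suml.
rewrite exchange_big /=; apply: eq_bigr => j _.
by rewrite big_cons mxE.
Qed.

(** Heights in a block of sign t, reflected so that every block goes up. *)
Definition flip m (t : bool) (i : 'I_m.+1) : 'I_m.+1 :=
  if t then rev_ord i else i.

Lemma flipK m t : involutive (@flip m t).
Proof. by case: t => //= i; rewrite /flip rev_ordK. Qed.

Lemma flip_le m t (i j : 'I_m.+1) : (flip t i <= flip t j)%N = step t i j.
Proof.
have [lei lej] := (ltn_ord i, ltn_ord j).
by case: t => //=; rewrite !subSS; lia.
Qed.

Lemma flip_neg m t (i : 'I_m.+1) : rev_ord (flip t i) = flip (~~ t) i.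
Proof. by case: t; rewrite //= /flip rev_ordK. Qed.

(** The truncation removes the last sign only: as the first entry is x + 1, the
    number of signs is x + 1 + sumn a. *)
Lemma size_walks_Lambda m t x a (i : 'I_m.+1) : all (leq 1) a ->
  (size (walks m i (take (x + sumn a) (signs_from t (x.+1 :: a)))))%:R =
  (\prod_(x <- x.+1 :: a) Lambda m x) (flip t i) ord0.
Proof.
elim: a t x i => [|y a IHa] t x i pos.
  elim: x i => [|x IHx] i.
    (* A single sign: no free step is left, and Lambda(1) has first column 1. *)
    by rewrite big_seq1 Lambda1_col.
  rewrite addSn [take _ _]/= size_walks_cons prod_LambdaS natr_sum.
  rewrite [RHS](reindex_inj (inv_inj (flipK t))) /=.
  by apply: eq_big => [j|j _]; rewrite ?flip_le //; apply: IHx.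
case/andP: pos => y0 pos.
elim: x i => [|x IHx] i; rewrite prod_LambdaS (reindex_inj (inv_inj (flipK t))) /=.
  (* The block ends: after this step the reflection Lambda(0) opens a block of
     the opposite sign. *)
  case: y y0 => // y _.
  rewrite add0n addSn /= -/(signs_from _ (y.+1 :: a)) size_walks_cons natr_sum.
  by apply: eq_big => [j|j _]; rewrite ?flip_le // prod_Lambda0 flip_neg -IHa //.
rewrite -/(signs_from _ _) [take _ _]/= size_walks_cons natr_sum.
by apply: eq_big => [j|j _]; rewrite ?flip_le //; apply: IHx.
Qed.

Lemma Omega_edge m : #|Omega m (snake_graph [::])| = 1%N.
Proof.
have eE : south (0%N, 0%N) \in snake_edges [::] by rewrite mem_head.
apply: (@eq_card1 _ [ffun => ord_max]) => g; apply/OmegaP/eqP => [deg|->].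
  apply/ffunP => e; rewrite ffunE; apply: val_inj => /=.
  have := deg (0, 0)%N _ eE isT.
  rewrite /degree big_cons big_nil /= addn0 => degE.
  by rewrite -(extend_val g e); have : val e \in _ := ssvalP e; rewrite inE => /eqP ->.
move=> v e; rewrite inE => /eqP-> inc; rewrite /degree big_cons inc big_nil addn0.
by rewrite -[X in extend _ X]/(val (SeqSub eE)) extend_val ffunE.
Qed.

Lemma numOmega_Lambda m a : all (leq 1) a ->
  (numOmega m a)%:R = (\prod_(x <- a) Lambda m x) ord0 ord0.
Proof.
case: a => [|x a] pos; first by rewrite big_nil mxE.
case/andP: (pos); case: x pos => // x pos _ pos'.
rewrite -[ord0 in X in X ord0](_ : flip false ord0 = ord0) // -size_walks_Lambda //.
rewrite /numOmega cf_snakeE /cf_tiles; set ss := take _ _; congr _%:R.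
have sz : size ss = (x + sumn a)%N.
  by rewrite size_take size_signs_from /= addSn ltnSn.
have ss0 : nth false ss 0 = false by rewrite /ss; case: (x + _)%N.
have -> : mkseq (cf_tile (x.+1 :: a)) (sumn (x.+1 :: a)).-1 =
    mkseq (tile_at (nth false ss)) (size ss).
  (* Only the signs s_0, ..., s_(d-1) enter the construction of d tiles. *)
  rewrite sz; apply/eq_in_map => k; rewrite mem_iota add0n => /andP[_ ltk].
  apply: cf_tile_at => // j lej; rewrite /ss nth_take //.
  exact: leq_ltn_trans ltk.
have [ss_nil|ss_gt0] := posnP (size ss); last exact: card_Omega_walks.
by rewrite (size0nil ss_nil) /= Omega_edge.
Qed.

(** The last row of any Lambda(x) is (1, 0, ..., 0). *)
Lemma prod_Lambda_last m x a :
  (\prod_(y <- x :: a) Lambda m y) ord_max ord0 =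
  (\prod_(y <- a) Lambda m y) ord0 ord0.
Proof.
rewrite big_cons mxE (bigD1 ord0) //= [X in _ + X]big1 => [|j j0].
  by rewrite addr0 mxE subrr subr0 [bracket _ _]/= bin0 mul1r.
rewrite mxE subrr sub0r bracket_neg ?mul0r // oppr_lt0.
by rewrite ltz_nat lt0n.
Qed.

Theorem theorem1p3 (m : nat) (hm : (1 <= m)%N) (x : rat) (hx : 1 <= x)
    (a1 : nat) (a : seq nat) (ha : all (leq 1) (a1 :: a))
    (hxa : x = cfrac (a1 :: a)) :
  r_rat m m x = (numOmega m (a1 :: a))%:R / (numOmega m a)%:R.
Proof.
case/andP: (ha) => _ ha'.
have inord0 : inord 0 = ord0 :> 'I_m.+1 by apply: val_inj; rewrite /= inordK.
by rewrite hxa r_ratE // /r_seq subnn inord0 prod_Lambda_last !numOmega_Lambda.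
Qed.
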